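(* Let $T=(T_1,\dots,T_n)$ be an $n$-tuple of near-isometries on a Hilbert space $\mathcal H$. Then the following statements are equivalent: (i) $T$ admits a Wold-type decomposition. (ii) $\mathcal H_{T_i,S}$ reduces $T_k$ for all $i,k\in I_n$. (iii) $\mathcal H_{T_i,I}$ reduces $T_k$ for all $i,k\in I_n$.
   Context: All Hilbert spaces are complex and separable; $I_n=\{1,\dots,n\}$. An operator $T\in B(\mathcal H)$ is a near-isometry if (i) there is $\delta>0$ with $\delta\|x\|\le\|Tx\|\le\|x\|$ for all $x\in\mathcal H$, and (ii) $T^{*n}T^{n+1}\mathcal H\subseteq T\mathcal H$ for each $n\ge 0$. $T$ is a shift operator on $\mathcal H$ if there is a closed subspace $\mathcal W\subseteq\mathcal H$ with $T^i\mathcal W\perp T^j\mathcal W$ for all non-negative integers $i\neq j$ and $\mathcal H=\bigoplus_{n=0}^\infty T^n\mathcal W$. For a near-isometry $T$ on $\mathcal H$ put $\mathcal H_{T,S}=\bigoplus_{n\ge0}T^n(\ker T^* )$ and $\mathcal H_{T,I}=\bigcap_{n\ge0}T^n\mathcal H$. (Known Wold-type decomposition for a near-isometry: $\mathcal H=\mathcal H_{T,S}\oplus\mathcal H_{T,I}$, both subspaces reduce $T$, $T|_{\mathcal H_{T,S}}$ is a shift operator and $T|_{\mathcal H_{T,I}}$ is invertible.) An $n$-tuple $(T_1,\dots,T_n)$ of near-isometries on $\mathcal H$ admits a Wold-type decomposition if there exist $2^n$ closed subspaces $\{\mathcal H_A\}_{A\subseteq I_n}$ of $\mathcal H$ (possibly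 zero), each reducing every $T_i$, such that $\mathcal H=\bigoplus_{A\subseteq I_n}\mathcal H_A$ (orthogonal direct sum), $T_i|_{\mathcal H_A}$ is a shift operator if $i\in A$, and $T_i|_{\mathcal H_A}$ is an invertible operator if $i\in I_n\setminus A$. *)

(* Defs.v *)
From HB Require Import structures.
From mathcomp Require Import all_boot all_order all_algebra.
From mathcomp Require Import complex.
From mathcomp Require Import all_classical all_reals all_analysis.
Set Implicit Arguments.
Unset Strict Implicit.
Unset Printing Implicit Defensive.
Import Order.TTheory GRing.Theory Num.Theory.
Import numFieldNormedType.Exports.
Local Open Scope classical_set_scope.
Local Open Scope ring_scope.
Local Open Scope complex_scope.

(* A complex Hilbert space is a complete normed space [H] over [R[i]] with an
   inner product [dot], linear in its first argument, that induces the norm. *)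
Definition induces_norm (R : realType) (H : completeNormedModType R[i])
    (dot : {dot H for Num.conj}) : Prop :=
  forall x : H, `|x| ^+ 2 = dot x x.

Definition separable (X : topologicalType) : Prop :=
  exists2 D : set X, countable D & dense D.

Section Operators.
Variables (R : realType) (H : completeNormedModType R[i]).
Variable dot : {dot H for Num.conj}.

Definition closed_subspace (M : set H) : Prop :=
  closed M /\ submod_closed [in M].

Definition perp (A B : set H) : Prop :=
  forall x y, A x -> B y -> dot x y = 0.

Definition orthocomp (A : set H) : set H :=
  [set x | forall y, A y -> dot x y = 0].

(* For pairwise orthogonal closed subspaces [E n], this is their Hilbert space
   direct sum: a series of orthogonal vectors converges in norm iff its terms
   are square-summable. *)
Definition hsum (E : nat -> set H) : set H :=
  [set x | exists2 u : nat -> H, (forall n, E n (u n)) & series u @ \oo --> x].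

(* The default value [0] is never used when [T] is linear and bounded: the
   vector [z] below then exists (Riesz) and is unique. *)
Definition adjoint (T : H -> H) (y : H) : H :=
  xget 0 [set z | forall x, dot (T x) y = dot x z].

Definition near_isometry (T : {linear H -> H}) : Prop :=
  [/\ continuous T,
      exists2 d : R, 0 < d & forall x, d%:C * `|x| <= `|T x| <= `|x|
    & forall n, range (iter n (adjoint T) \o iter n.+1 T) `<=` range T].

Definition reduces (T : H -> H) (M : set H) : Prop :=
  T @` M `<=` M /\ T @` orthocomp M `<=` orthocomp M.

(* The restriction of [T] to the closed [T]-invariant subspace [M] is a shift
   operator on [M]. *)
Definition shift_on (T : H -> H) (M : set H) : Prop :=
  exists W : set H,
    [/\ closed_subspace W, W `<=` M,
        forall i j : nat, i != j -> perp (iter i T @` W) (iter j T @` W)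
      & M = hsum (fun n => iter n T @` W)].

(* [S], whose values outside [M] are irrelevant, represents an element of
   B(M). *)
Definition bounded_operator_on (M : set H) (S : H -> H) : Prop :=
  [/\ S @` M `<=` M,
      forall (a : R[i]) x y, M x -> M y -> S (a *: x + y) = a *: S x + S y
    & exists c : R, forall x, M x -> `|S x| <= c%:C * `|x|].

(* The restriction of [T] to [M] is an invertible element of B(M). *)
Definition invertible_on (T : H -> H) (M : set H) : Prop :=
  bounded_operator_on M T /\
  exists2 S : H -> H, bounded_operator_on M S
    & forall x, M x -> S (T x) = x /\ T (S x) = x.

Definition shift_part (T : H -> H) : set H :=
  hsum (fun n => iter n T @` [set x | adjoint T x = 0]).

Definition invertible_part (T : H -> H) : set H :=
  \bigcap_n range (iter n T).

Definition admits_wold n (T : 'I_n -> {linear H -> H}) : Prop :=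
  exists HA : {set 'I_n} -> set H,
    [/\ forall A, closed_subspace (HA A) /\ forall i, reduces (T i) (HA A),
        forall A B, A != B -> perp (HA A) (HA B),
        forall x, exists2 u : {set 'I_n} -> H,
          (forall A, HA A (u A)) & x = \sum_A u A
      & forall (A : {set 'I_n}) (i : 'I_n),
          (i \in A -> shift_on (T i) (HA A)) /\
          (i \notin A -> invertible_on (T i) (HA A))].

End Operators.

(* Main.v *)
(** For a near-isometry [T], the inclusion [T*^n T^(n+1) H <= T H] makes
    [T^n W], where [W] is the kernel of [T*], orthogonal to [T^(n+1) H].
    Iterating [x = w + T y] with [w] in [W] inside a subspace [M] reducing [T]
    therefore gives an orthogonal expansion of [x] along the [T^n (M `&` W)],
    whose remainder lies in the invertible part; for [M = H], the shift part and
    the invertible part are orthogonal complements of each other, so (ii) and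
    (iii) agree.

    Under (ii), a splitting along one shift part respects the shift and
    invertible parts of all the other operators, so successive splittings write
    each vector as a sum over [A] of vectors of the intersection of the shift
    parts (for [i] in [A]) and invertible parts (for [i] not in [A]); the
    expansion inside reducing subspaces shows that the operators act on this
    intersection as required. Conversely, each [HA A] is contained in the shift
    or in the invertible part of [T i] according to [i \in A], so that these
    parts are sums of the [HA A]. *)
Require Import Defs.
From HB Require Import structures.
From mathcomp Require Import all_boot all_order all_algebra.
From mathcomp Require Import complex.
From mathcomp Require Import all_classical all_reals all_analysis.
From mathcomp Require Import ring.
Set Implicit Arguments.
Unset Strict Implicit.
Unset Printing Implicit Defensive.
Import Order.TTheory GRing.Theory Num.Theory.
Import numFieldNormedType.Exports.
Local Open Scope classical_set_scope.
Local Open Scope ring_scope.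
Local Open Scope complex_scope.

(** * Inner product calculus and the Cauchy-Schwarz inequality *)

Section InnerProduct.
Variables (R : realType) (H : completeNormedModType R[i]).
Variable dot : {dot H for Num.conj}.
Hypothesis dot_norm : induces_norm dot.

Lemma dotC x y : dot x y = (dot y x)^*%R.
Proof. by rewrite hermC expr0 mul1r. Qed.

Lemma dot_eq0C x y : dot x y = 0 -> dot y x = 0.
Proof. by move=> xy0; rewrite dotC xy0 rmorph0. Qed.

Lemma dotZr a x y : dot x (a *: y) = a^*%R * dot x y.
Proof. exact: linearZr_LR. Qed.

Lemma dotZl a x y : dot (a *: x) y = a * dot x y.
Proof. exact: linearZl_LR. Qed.

Lemma dotDl x y z : dot (x + y) z = dot x z + dot y z.
Proof. exact: linearDl. Qed.

Lemma dotDr x y z : dot x (y + z) = dot x y + dot x z.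
Proof. exact: linearDr. Qed.

Lemma dotBl x y z : dot (x - y) z = dot x z - dot y z.
Proof. exact: linearBl. Qed.

Lemma dotBr x y z : dot x (y - z) = dot x y - dot x z.
Proof. exact: linearBr. Qed.

Lemma dot0l x : dot 0 x = 0.
Proof. exact: linear0l. Qed.

Lemma dot0r x : dot x 0 = 0.
Proof. exact: linear0r. Qed.

Lemma dot_self_eq0 x : dot x x = 0 -> x = 0.
Proof. by move/eqP; rewrite dnorm_eq0 => /eqP. Qed.

(* The case [d = 0], [e = dot z z] is the Cauchy-Schwarz inequality. *)
Lemma dot_near_minimizer (d e : R[i]) (z v : H) :
  (forall a, d <= dot (z - a *: v) (z - a *: v)) -> dot z z <= d + e ->
  `|dot z v| ^+ 2 <= e * dot v v.
Proof.
move=> dmin ze; have [->|v0] := eqVneq v 0.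
  by rewrite !dot0r normr0 expr0n mulr0.
have b0 : 0 < dot v v by rewrite dnorm_gt0.
have bn0 : dot v v != 0 by rewrite gt_eqF.
rewrite -ler_pdivrMr//.
(* This coefficient gives the multiple of [v] closest to [z]; the squared distance is then
   [dot z z - t]. *)
have := dmin (dot z v / dot v v).
set a := dot z v / dot v v; set t := _ / dot v v.
have tr : t^*%R = t.
  by apply/CrealP/ger0_real; rewrite divr_ge0// ?exprn_ge0// ltW.
have dt : dot z (a *: v) = t.
  rewrite dotZr /a rmorphM mulrAC [X in X * _]mulrC -normCK.
  have /CrealP br : (dot v v)^-1 \is Num.real.
    by rewrite ger0_real// invr_ge0 ltW.
  by congr (_ * _); exact: br.
have nt : dot (a *: v) (a *: v) = t.
  by rewrite dotZl dotC dotZl /a divfK// mulrAC -normCK.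
rewrite dnormB dt nt tr opprD addrA addrK => dz.
by rewrite -(lerD2l d); apply: le_trans ze; rewrite -lerBrDr.
Qed.

Lemma dot_CauchySchwarz x y : `|dot x y| <= `|x| * `|y|.
Proof.
rewrite -(@ler_pXn2r _ 2)// ?nnegrE ?mulr_ge0// exprMn !dot_norm.
by apply: (@dot_near_minimizer 0) => [a|]; rewrite ?dnorm_ge0 ?add0r.
Qed.

(** * Limits of sequences in norm *)

Lemma cvg_normP (u : nat -> H) (l : H) :
  u @ \oo --> l <->
  forall e : R[i], 0 < e -> exists N, forall n, (N <= n)%N -> `|l - u n| < e.
Proof.
split=> [/cvgrPdist_lt ul e /ul[N _ uN]|ul].
  by exists N => n Nn; apply: uN.
by apply/cvgrPdist_lt => e /ul[N uN]; exists N.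
Qed.

(** Cauchy-Schwarz controls [dot (l - u n) y]. The values [dot (u n) y] need only tend to [0], as
    happens along a minimizing sequence. *)
Lemma dot_lim_eq0 (u : nat -> H) l y : u @ \oo --> l ->
  (forall e : R[i], 0 < e ->
     exists N, forall n, (N <= n)%N -> `|dot (u n) y| < e) ->
  dot l y = 0.
Proof.
move=> /cvg_normP ul uy; apply/eqP/negPn/negP; rewrite -normr_gt0 => ly.
have y0 : 0 < `|y| + 1 by rewrite ltr_wpDl.
have e0 : 0 < `|dot l y| / 2 by rewrite divr_gt0.
have [N uN] := ul _ (divr_gt0 e0 y0); have [N' uN'] := uy _ e0.
have /uN := leq_maxl N N'; have /uN' := leq_maxr N N'.
set v := u _; rewrite (ltr_pdivlMr _ _ y0) => vy lv.
suff : `|dot l y| < `|dot l y| by rewrite ltxx.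
have := ler_normD (dot (l - v) y) (dot v y); rewrite -dotDl subrK.
move=> /le_lt_trans; apply; rewrite [ltRHS]splitr; apply: ltrD => //.
apply: le_lt_trans lv.
by apply: le_trans (dot_CauchySchwarz _ _) _; rewrite ler_wpM2l// lerDl.
Qed.

(** The order on [R[i]] compares only numbers with equal imaginary parts; this brings epsilons back
    to [R]. *)
Lemma posC (e : R[i]) : 0 < e -> exists2 r : R, 0 < r & e = r%:C.
Proof.
case: e => a b; rewrite ltcE /= => /andP[/eqP -> a0].
by exists a.
Qed.

Lemma closed_cvgn (M : set H) (u : nat -> H) l :
  closed M -> (forall n, M (u n)) -> u @ \oo --> l -> M l.
Proof. by move=> cM uM; apply: closed_cvg => //; apply: nearW. Qed.

(** Balls of radius [1/(n+1)] around a point of the closure yield a sequence in [M] converging to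
    it. *)
Lemma closed_cvgnP (M : set H) :
  (forall (u : nat -> H) l, (forall n, M (u n)) -> u @ \oo --> l -> M l) ->
  closed M.
Proof.
move=> Mlim l Ml.
have /choice[u uP] : forall n : nat, exists v, M v /\ `|l - v| < n.+1%:R^-1.
  move=> n; have [|v [Mv lv]] := Ml (ball l n.+1%:R^-1).
    by apply: nbhsx_ballx; rewrite invr_gt0.
  by exists v; split => //; move: lv; rewrite -ball_normE.
apply: (Mlim u) => [n|]; first by have [] := uP n.
apply/cvg_normP => _ /posC[r r0 ->].
have [N _ Ne] := near_infty_natSinv_lt (PosNum r0).
exists N => n /Ne /= nr; have [_ lu] := uP n; apply: lt_trans lu _.
by rewrite -(rmorph_nat (real_complex R)) -fmorphV ltcR.
Qed.

Lemma cauchy_dist_cvg (u : nat -> H) :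
  (forall e : R[i], 0 < e -> exists N, forall n m, (N <= n)%N -> (N <= m)%N ->
     `|u n - u m| < e) ->
  exists l : H, u @ \oo --> l.
Proof.
move=> uC; suff ul : cvg (u @ \oo) by exists (lim (u @ \oo)).
apply: cauchy_cvg; apply: cauchy_exP => e /uC[N uN]; exists (u N), N => // n /=.
by move=> Nn; rewrite -ball_normE /ball_ /=; apply: uN.
Qed.

(** * Closed subspaces *)

Lemma closed_subspaceP (M : set H) :
  closed_subspace M <->
  [/\ closed M, M 0 & forall a x y, M x -> M y -> M (a *: x + y)].
Proof.
split=> [[cM [M0 Ml]]|[cM M0 Ml]].
  split=> // [|a x y Mx My]; first by rewrite inE in M0.
  by have := Ml a x y; rewrite !inE; apply.
by split=> //; split=> [|a x y]; rewrite !inE//; apply: Ml.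
Qed.

Section ClosedSubspace.
Variable M : set H.
Hypothesis cM : closed_subspace M.

Lemma subspace0 : M 0.
Proof. by have /closed_subspaceP[] := cM. Qed.

Lemma subspaceD x y : M x -> M y -> M (x + y).
Proof.
by have /closed_subspaceP[_ _ Ml] := cM; rewrite -{2}(scale1r x); apply: Ml.
Qed.

Lemma subspaceZ a x : M x -> M (a *: x).
Proof.
have /closed_subspaceP[_ M0 Ml] := cM => Mx.
by rewrite -[_ *: _]addr0; apply: Ml.
Qed.

Lemma subspaceN x : M x -> M (- x).
Proof. by rewrite -scaleN1r; apply: subspaceZ. Qed.

Lemma subspaceB x y : M x -> M y -> M (x - y).
Proof. by move=> Mx My; apply/subspaceD/subspaceN. Qed.

Lemma subspace_sum (I : Type) (s : seq I) (P : pred I) (F : I -> H) :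
  (forall i, P i -> M (F i)) -> M (\sum_(i <- s | P i) F i).
Proof.
by move=> MF; apply: big_ind => //; [exact: subspace0 | exact: subspaceD].
Qed.

Lemma subspace_lim (u : nat -> H) l :
  (forall n, M (u n)) -> u @ \oo --> l -> M l.
Proof. by have [cl _] := cM; apply: closed_cvgn. Qed.

End ClosedSubspace.

(** * Orthogonal projection and orthogonal complements *)

Lemma dot_real z : dot z z = (complex.Re (dot z z))%:C.
Proof. by rewrite RRe_real// ger0_real// dnorm_ge0. Qed.

Lemma parallelogram x y :
  dot (x + y) (x + y) + dot (x - y) (x - y) = 2 * (dot x x + dot y y).
Proof. rewrite !dotBl !dotBr !dotDl !dotDr; ring. Qed.

(** Parallelogram law for [x - p] and [x - q]: half their sum is [x] minus the midpoint of [p] and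
    [q], a point of [M], so its square norm is at least [d]. *)
Lemma near_minimizer_dist (M : set H) x (d : R[i]) e p q :
  closed_subspace M -> (forall m, M m -> d <= dot (x - m) (x - m)) ->
  M p -> M q -> dot (x - p) (x - p) <= d + e -> dot (x - q) (x - q) <= d + e ->
  `|p - q| ^+ 2 <= 4 * e.
Proof.
move=> cM dmin Mp Mq pe qe; rewrite dot_norm.
have Mm : M (2^-1 *: (p + q)) by apply: subspaceZ => //; apply: subspaceD.
have := parallelogram (x - q) (x - p).
have -> : x - q - (x - p) = p - q by rewrite opprB addrC subrKA.
have -> : x - q + (x - p) = 2 *: (x - 2^-1 *: (p + q)).
  rewrite scalerBr scalerA divff// scale1r scaler_nat opprD addrACA.
  by rewrite [- q - p]addrC.
have := dmin _ Mm; set m := x - _ => dm.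
rewrite dotZl dotZr rmorph_nat => /(canRL (addKr _)) ->.
rewrite addrC lerBlDr; apply: (@le_trans _ _ (2 * (d + e + (d + e)))).
  by rewrite ler_pM2l// lerD.
have -> : 2 * (d + e + (d + e)) = 4 * e + 4 * d by ring.
have -> : 2 * (2 * dot m m) = 4 * dot m m by ring.
by rewrite lerD2l ler_pM2l.
Qed.

(** Vectors of [M] that nearly minimize the distance to [x] form a Cauchy sequence; its limit is
    [y], and minimality makes [x - y] orthogonal to [M]. *)
Lemma projection (M : set H) x : closed_subspace M ->
  exists y z, [/\ M y, orthocomp dot M z & x = y + z].
Proof.
move=> cM; pose f m := complex.Re (dot (x - m) (x - m)).
pose d := inf [set f m | m in M].
have f0 m : 0 <= f m by rewrite -ler0c -dot_real dnorm_ge0.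
have fi : has_inf [set f m | m in M].
  split; first by exists (f 0), 0 => //; apply: subspace0.
  by exists 0 => _ [m _ <-].
have dmin m : M m -> d%:C <= dot (x - m) (x - m).
  by move=> Mm; rewrite dot_real lecR; apply: ge_inf; [case: fi | exists m].
have /choice[u uP] : forall n : nat, exists v, M v /\
    dot (x - v) (x - v) <= d%:C + n.+1%:R^-1.
  move=> n; have n0 : 0 < n.+1%:R^-1 :> R by rewrite invr_gt0.
  have [_ [v Mv <-] /ltW vd] := inf_adherent n0 fi; exists v; split => //.
  by rewrite -(rmorph_nat (real_complex R)) -fmorphV -rmorphD /= dot_real lecR.
have uM n : M (u n) by have [] := uP n.
have ud N n : (N <= n)%N ->
    dot (x - u n) (x - u n) <= d%:C + N.+1%:R^-1.
  move=> Nn; have [_ h] := uP n; apply: le_trans h _.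
  by rewrite lerD2l lef_pV2 ?posrE// ler_nat.
have arch (e : R[i]) : 0 < e -> exists N : nat, N.+1%:R^-1 < e.
  move=> /posC[r r0 ->]; have [N _ Ne] := near_infty_natSinv_lt (PosNum r0).
  exists N; rewrite -(rmorph_nat (real_complex R)) -fmorphV ltcR.
  exact: (Ne N (leqnn N)).
have [p up] : exists p : H, u @ \oo --> p.
  apply: cauchy_dist_cvg => e e0.
  have [|N Ne] := arch (e ^+ 2 / 4); first by rewrite divr_gt0// exprn_gt0.
  exists N => n m Nn Nm.
  rewrite -(@ltr_pXn2r _ 2)// ?nnegrE ?(ltW e0)//.
  have := near_minimizer_dist cM dmin (uM n) (uM m) (ud _ _ Nn) (ud _ _ Nm).
  move=> /le_lt_trans; apply.
  by rewrite mulrC -ltr_pdivlMr.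
exists p, (x - p); split; first exact: subspace_lim up.
  move=> v Mv; apply: (@dot_lim_eq0 (fun n => x - u n)).
    by apply: cvgB => //; apply: cvg_cst.
  (* The added [1] keeps the divisor positive when [v = 0]. *)
  move=> e e0; have v0 : 0 < dot v v + 1 by rewrite ltr_wpDl ?dnorm_ge0.
  have [N Ne] := arch (e ^+ 2 / (dot v v + 1)) (divr_gt0 (exprn_gt0 2%N e0) v0).
  exists N => n Nn; rewrite -(@ltr_pXn2r _ 2)// ?nnegrE ?(ltW e0)//.
  apply: (@le_lt_trans _ _ (N.+1%:R^-1 * dot v v)).
    apply: (@dot_near_minimizer d%:C) (ud _ _ Nn) => a.
    rewrite -addrA -opprD; apply: dmin; apply: subspaceD => //.
    exact: subspaceZ.
  move: Ne; rewrite ltr_pdivlMr//; apply: le_lt_trans.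
  by rewrite ler_wpM2l ?invr_ge0// lerDl.
by rewrite addrC subrK.
Qed.

Lemma orthocomp_closed_subspace (A : set H) : closed_subspace (orthocomp dot A).
Proof.
apply/closed_subspaceP; split=> [|y _|a x y Ax Ay z Az]; last 2 first.
- exact: dot0l.
- by rewrite dotDl dotZl Ax// Ay// mulr0 addr0.
apply: closed_cvgnP => u l Au ul y Ay; apply: dot_lim_eq0 ul _ => e e0.
by exists 0%N => n _; rewrite Au// normr0.
Qed.

(** If [x] is orthogonal to [B], its component in [B] is orthogonal to itself, hence zero. *)
Lemma orthocomp_eq (A B : set H) : perp dot A B ->
  (forall x, exists a b, [/\ A a, B b & x = a + b]) -> A = orthocomp dot B.
Proof.
move=> AB split_AB; apply/seteqP; split=> [x Ax y By|x xB]; first exact: AB.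
have [a [b [Aa Bb xE]]] := split_AB x.
suff b0 : b = 0 by rewrite xE b0 addr0.
by apply: dot_self_eq0; have := xB _ Bb; rewrite xE dotDl (AB a b)// add0r.
Qed.

Lemma perpC (A B : set H) : perp dot A B -> perp dot B A.
Proof. by move=> AB x y Bx Ay; apply/dot_eq0C/AB. Qed.

Lemma orthocompK (M : set H) : closed_subspace M ->
  orthocomp dot (orthocomp dot M) = M.
Proof.
move=> cM; apply/esym/orthocomp_eq => [x y Mx My|x]; last exact: projection.
exact/dot_eq0C/My.
Qed.

Lemma dot_inj y z : (forall x, dot x y = dot x z) -> y = z.
Proof.
move=> yz; apply/eqP; rewrite -subr_eq0; apply/eqP/dot_self_eq0.
by rewrite dotBr yz subrr.
Qed.

(** * Adjoints and reducing subspaces *)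

Section BoundedOperator.
Variable T : {linear H -> H}.
Hypothesis cT : continuous T.

Lemma cvg_op (u : nat -> H) l : u @ \oo --> l -> (T \o u) @ \oo --> T l.
Proof. by move=> ul; apply: continuous_cvg => //; apply: cT. Qed.

(** Riesz representation of the functional [x |-> dot (T x) y]: the vector sought is found in the
    orthogonal complement of its kernel [K]. *)
Lemma adjointP x y : dot (T x) y = dot x (adjoint dot T y).
Proof.
suff [z zP] : exists z, forall x, dot (T x) y = dot x z.
  by rewrite /adjoint; case: xgetP => [w _ /(_ x)//|/(_ z)].
pose K := [set x | dot (T x) y = 0].
have cK : closed_subspace K.
  apply/closed_subspaceP; split=> [||a u v]; rewrite /K /=; last 2 first.
  - by rewrite linear0 dot0l.
  - by move=> Ku Kv; rewrite linearP dotDl dotZl Ku Kv mulr0 addr0.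
  apply: closed_cvgnP => u l Ku /cvg_op ul; apply: dot_lim_eq0 ul _ => e e0.
  by exists 0%N => n _ /=; rewrite Ku normr0.
have [KT|/existsNP[x0 Kx0]] := pselect (forall x, K x).
  by exists 0 => x'; rewrite dot0r; apply: KT.
have [k [z [Kk Kz x0E]]] := projection x0 cK.
have Tz0 : dot (T z) y != 0.
  apply/eqP => Tz; apply: Kx0; rewrite /K /= x0E linearD dotDl Tz.
  by rewrite Kk addr0.
have zz0 : dot z z != 0.
  by apply: contraNneq Tz0 => /dot_self_eq0 ->; rewrite linear0 dot0l.
exists ((dot (T z) y / dot z z)^*%R *: z) => x'.
rewrite dotZr conjCK.
(* The coefficients are chosen so that the functional vanishes on this combination, which thus lies
   in [K]. *)
have /dot_eq0C : dot z (dot (T z) y *: x' - dot (T x') y *: z) = 0.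
  apply: Kz; rewrite /K /= (linearB T) !(linearZ_LR T) dotBl !dotZl.
  by rewrite mulrC subrr.
rewrite dotBl !dotZl => /eqP; rewrite subr_eq0 => /eqP h.
by rewrite mulrAC h mulfK.
Qed.

Lemma ker_adjointP w : adjoint dot T w = 0 <-> forall z, dot (T z) w = 0.
Proof.
split=> [w0 z|w0]; first by rewrite adjointP w0 dot0r.
by apply: dot_inj => x; rewrite -adjointP w0 dot0r.
Qed.

Lemma iter_adjointP n x y :
  dot (iter n T x) y = dot x (iter n (adjoint dot T) y).
Proof. by elim: n x y => // n IH x y; rewrite iterS adjointP IH -iterSr. Qed.

(** Moving [T] across the inner product turns invariance of the complement into invariance of [M]
    under the adjoint; [M] is its own double complement. *)
Lemma reduces_adjoint (M : set H) : closed_subspace M ->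
  reduces dot T M <-> T @` M `<=` M /\ adjoint dot T @` M `<=` M.
Proof.
move=> cM; split=> -[TM TM']; split=> //.
  move=> _ [m Mm <-]; rewrite -[X in X _](orthocompK cM) => p Mp.
  rewrite dotC -adjointP -dotC; apply/dot_eq0C.
  by apply: TM' => //; exists p.
move=> _ [p Mp <-] m Mm; rewrite adjointP; apply: Mp; apply: TM'.
by exists m.
Qed.

End BoundedOperator.

(** * Iterates, increasing projections and Hilbert sums *)

Lemma iter_linear (T : {linear H -> H}) n a x y :
  iter n T (a *: x + y) = a *: iter n T x + iter n T y.
Proof. by elim: n => //= n ->; rewrite linearP. Qed.

Lemma iter_add (T : {linear H -> H}) n x y :
  iter n T (x + y) = iter n T x + iter n T y.
Proof. by rewrite -{1}(scale1r x) iter_linear scale1r. Qed.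

Lemma iter_inv (M : set H) (f : H -> H) n x : f @` M `<=` M -> M x ->
  M (iter n f x).
Proof. by move=> fM Mx; elim: n => //= n Mn; apply: fM; exists (iter n f x). Qed.

Lemma range_iter_le (f : H -> H) m n : (m <= n)%N ->
  range (iter n f) `<=` range (iter m f).
Proof.
move=> /subnKC <- _ [x _ <-]; rewrite iterD.
by exists (iter (n - m) f x).
Qed.

(* If each [S n] is the orthogonal projection of [x] onto an increasing family
   of subspaces, then [S] converges: its norms increase and are bounded. *)
Lemma cvg_increasing_projections (S : nat -> H) x :
  (forall m n, (m <= n)%N -> dot (S m) (S n - S m) = 0) ->
  (forall n, dot (S n) (x - S n) = 0) ->
  exists l : H, S @ \oo --> l.
Proof.
move=> Smono Sx; pose a n := complex.Re (dot (S n) (S n)).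
have pyth (y z : H) : dot y (z - y) = 0 ->
    dot z z = dot y y + dot (z - y) (z - y).
  have [d ->] : exists d, z = y + d by exists (z - y); rewrite addrC subrK.
  rewrite [y + d]addrC addrK => yd.
  by rewrite !dotDl !dotDr yd (dot_eq0C yd) addr0 add0r addrC.
have aE n : dot (S n) (S n) = (a n)%:C by apply: dot_real.
have a_mono m n : (m <= n)%N -> a m <= a n.
  move=> mn; rewrite -lecR -!aE (pyth _ _ (Smono _ _ mn)).
  by rewrite lerDl dnorm_ge0.
have a_ub n : a n <= complex.Re (dot x x).
  by rewrite -lecR -aE -dot_real (pyth _ _ (Sx n)) lerDl dnorm_ge0.
have a_cvg : cvg (a @ \oo).
  apply: nondecreasing_is_cvgn; first by move=> m n; apply: a_mono.
  by exists (complex.Re (dot x x)) => _ [n _ <-].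
apply: cauchy_dist_cvg => _ /posC[e e0 ->].
have /cvgrPdist_lt/(_ (e ^+ 2)) [|N _ aN] := a_cvg; first exact: exprn_gt0.
exists N => n m; wlog nm : n m / (m <= n)%N.
  move=> h Nn Nm; have [mn|/ltnW nm] := leqP m n; first exact: h.
  by rewrite distrC; apply: h.
move=> Nn Nm; rewrite -(@ltr_pXn2r _ 2)// ?nnegrE ?ler0c ?(ltW e0)//.
rewrite dot_norm.
have -> : dot (S n - S m) (S n - S m) = (a n - a m)%:C.
  by rewrite rmorphB /= -!aE (pyth _ _ (Smono _ _ nm)) [RHS]addrC addKr.
rewrite -rmorphXn ltcR.
have a_lim k : a k <= lim (a @ \oo).
  by apply: nondecreasing_cvgn_le => // i j; apply: a_mono.
have := aN m Nm; rewrite /= ger0_norm ?subr_ge0//; apply: le_lt_trans.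
by rewrite lerD2r.
Qed.

Lemma setT_closed_subspace : closed_subspace [set: H].
Proof. by apply/closed_subspaceP; split=> //; exact: closedT. Qed.

Lemma hsum_sub (E : nat -> set H) (M : set H) : closed_subspace M ->
  (forall n, E n `<=` M) -> hsum E `<=` M.
Proof.
move=> cM EM x [u Eu]; apply: subspace_lim => // n.
by apply: subspace_sum => // i _; apply/EM/Eu.
Qed.

Lemma hsum_mono (E F : nat -> set H) :
  (forall n, E n `<=` F n) -> hsum E `<=` hsum F.
Proof. by move=> EF x [u Eu ux]; exists u => // n; apply/EF/Eu. Qed.

(** * Wold decomposition of a single near-isometry *)

Section NearIsometry.
Variable T : {linear H -> H}.
Hypothesis nearT : near_isometry dot T.

Lemma near_isometry_continuous : continuous T.
Proof. by case: nearT. Qed.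
#[local] Hint Resolve near_isometry_continuous : core.

Lemma near_isometry_bounded_below :
  exists2 d : R, 0 < d & forall x, `|x| <= d%:C * `|T x|.
Proof.
have [_ [d d0 dT] _] := nearT; exists d^-1; first by rewrite invr_gt0.
move=> x; have /andP[dx _] := dT x.
by rewrite fmorphV -ler_pdivrMl ?invr_gt0 ?ltcR// invrK.
Qed.

Lemma near_isometry_contraction x : `|T x| <= `|x|.
Proof. by have [_ [d _ dT] _] := nearT; have /andP[] := dT x. Qed.

Lemma near_isometry_inj : injective T.
Proof.
move=> x y Txy; have [d _ /(_ (x - y))] := near_isometry_bounded_below.
rewrite (linearB T) Txy subrr normr0 mulr0 normr_le0 subr_eq0.
by move/eqP.
Qed.

(** As [T] is bounded below, convergence of [T (u n)] makes [u] a Cauchy sequence, so the limit is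
    the image of a vector of [M]. *)
Lemma image_closed_subspace (M : set H) :
  closed_subspace M -> closed_subspace (T @` M).
Proof.
move=> cM; apply/closed_subspaceP; split=> [||a _ _ [x Mx <-] [y My <-]].
- apply: closed_cvgnP => v l /(_ _)/cid2-/all_sig2[u Mu uv] /cvg_normP vl.
  have [d d0 dT] := near_isometry_bounded_below.
  have dC0 : 0 < d%:C by rewrite ltcR.
  have [k uk] : exists k : H, u @ \oo --> k.
    apply: cauchy_dist_cvg => e e0.
    have [|N vN] := vl (e / d%:C / 2); first by rewrite !divr_gt0.
    exists N => n m Nn Nm; apply: le_lt_trans (dT _) _.
    rewrite (linearB T) !uv mulrC -ltr_pdivlMr// [ltRHS]splitr.
    have -> : v n - v m = (l - v m) - (l - v n).
      by rewrite opprB [RHS]addrC subrKA.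
    by apply: le_lt_trans (ler_normB _ _) _; rewrite ltrD// vN.
  exists k; first exact: subspace_lim uk.
  have Tuv : T \o u = v by apply/funext => n /=; rewrite uv.
  have := cvg_op near_isometry_continuous uk; rewrite Tuv => vk.
  exact: (cvg_unique (@norm_hausdorff _ _) vk (proj2 (cvg_normP v l) vl)).
- by exists 0; [exact: subspace0 | rewrite linear0].
- exists (a *: x + y); last by rewrite linearP.
  by apply: subspaceD => //; apply: subspaceZ.
Qed.

Lemma range_iter_closed_subspace n : closed_subspace (range (iter n T)).
Proof.
elim: n => [|n IH].
  have -> : range (iter 0 T) = setT by apply/seteqP; split=> // x _; exists x.
  exact: setT_closed_subspace.
have -> : range (iter n.+1 T) = T @` range (iter n T).
  by rewrite image_comp.
exact: image_closed_subspace.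
Qed.

Lemma invertible_part_closed_subspace : closed_subspace (invertible_part T).
Proof.
apply/closed_subspaceP; split=> [|n _|a x y Ix Iy n _].
- apply: closed_bigI => n _.
  by have [] := range_iter_closed_subspace n.
- by apply: subspace0; apply: range_iter_closed_subspace.
- have cn := range_iter_closed_subspace n.
  by apply: subspaceD => //; [apply: subspaceZ => //; apply: Ix | apply: Iy].
Qed.

(* [dot (T^n w) (T^(n+1) x) = dot w (T*^n T^(n+1) x)] and [T*^n T^(n+1) x] is in
   the range of [T]. *)
Lemma iter_ker_adjoint_perp n w x : adjoint dot T w = 0 ->
  dot (iter n T w) (iter n.+1 T x) = 0.
Proof.
have [_ _ rT] := nearT; move=> w0; rewrite iter_adjointP//.
have [z _ <-] : range T (iter n (adjoint dot T) (iter n.+1 T x)).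
  by apply: rT; exists x.
by apply: dot_eq0C; move: z; apply/ker_adjointP.
Qed.

(** With [y = m + p] split along [M], the vector [T p] lies in [M] and in its complement, so it is
    zero, and [T] is injective. *)
Lemma reduces_split (M : set H) y : closed_subspace M -> reduces dot T M ->
  M (T y) -> M y.
Proof.
move=> cM [TM TM'] MTy; have [m [p [Mm Mp yE]]] := projection y cM.
suff p0 : p = 0 by rewrite yE p0 addr0.
apply: near_isometry_inj; rewrite linear0; apply: dot_self_eq0.
apply: (TM' (T p)); first by exists p.
have -> : T p = T y - T m by rewrite yE linearD addrC addKr.
by apply: subspaceB => //; apply: TM; exists m.
Qed.

(** Project [x] on [T M]. The remainder is orthogonal to [T M], and also to the image of the
    complement of [M] since [M] reduces [T]; so it is orthogonal to the whole range. *)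
Lemma wandering_split (M : set H) x : closed_subspace M -> reduces dot T M ->
  M x ->
  exists wy, [/\ M wy.1, adjoint dot T wy.1 = 0, M wy.2 & x = wy.1 + T wy.2].
Proof.
move=> cM rM Mx.
have [_ [w [[y My <-] wM xE]]] := projection x (image_closed_subspace cM).
exists (w, y); have [TM TM'] := rM.
have Mw : M w.
  have -> : w = x - T y by rewrite xE addrC addKr.
  by apply: subspaceB => //; apply: TM; exists y.
split=> //; last by rewrite addrC.
apply/ker_adjointP => // z; have [m [p [Mm Mp ->]]] := projection z cM.
rewrite linearD dotDl (dot_eq0C (wM _ _)) ?add0r; last by exists m.
by apply: (TM' (T p)) => //; exists p.
Qed.

(** For a reducing [M], this is the kernel of the adjoint of the restriction of [T] to [M]. *)
Definition wandering_part (M : set H) : set H :=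
  [set w | M w /\ adjoint dot T w = 0].

(** The partial sums of the iterated splitting are orthogonal to its remainders, hence converge;
    from stage [m] on the remainders lie in the closed [range (iter m T)], and so does their
    limit. *)
Lemma wold_reducing (M : set H) x : closed_subspace M -> reduces dot T M ->
  M x -> exists s t, [/\ hsum (fun n => iter n T @` wandering_part M) s,
    invertible_part T t & x = s + t].
Proof.
move=> cM rM Mx.
have /choice[f fP] : forall z, exists wy, M z ->
    [/\ M wy.1, adjoint dot T wy.1 = 0, M wy.2 & z = wy.1 + T wy.2].
  move=> z; have [Mz|nMz] := pselect (M z); last by exists (0, 0).
  by have [wy wyP] := wandering_split cM rM Mz; exists wy.
(* Starting from [y 0 = x], each stage splits [y n] as [w n + T (y n.+1)]. *)
pose y n := iter n (fun z => (f z).2) x; pose w n := (f (y n)).1.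
have My n : M (y n) by elim: n => //= n /fP[].
pose v n := iter n T (w n).
have xE n : x = series v n + iter n T (y n).
  elim: n => [|n IH]; first by rewrite /series /= big_geq// add0r.
  rewrite {1}IH seriesSr -addrA; congr (_ + _).
  have [_ _ _ yE] := fP _ (My n); rewrite {1}yE iter_add; congr (_ + _).
  by rewrite -iterSr.
have Sperp m z : range (iter m T) z -> dot (series v m) z = 0.
  move=> zm; rewrite /series /= linear_sumlz big_nat big1// => k /andP[_ km].
  have /= [z' _ <-] := range_iter_le km zm.
  by apply: iter_ker_adjoint_perp; have [] := fP _ (My k).
have xS m n : (m <= n)%N -> range (iter m T) (x - series v n).
  move=> mn; apply: (range_iter_le mn); exists (y n) => //.
  by rewrite [in RHS](xE n) addrC addKr.
have [s vs] : exists s : H, series v @ \oo --> s.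
  apply: (@cvg_increasing_projections _ x) => [m n mn|n]; apply: Sperp.
    have -> : series v n - series v m = (x - series v m) - (x - series v n).
      by rewrite opprB [RHS]addrC subrKA.
    by apply: (subspaceB (range_iter_closed_subspace m)); apply: xS.
  exact: xS.
exists s, (x - s); split; last by rewrite addrC subrK.
  by exists v => // n; exists (w n) => //; have [] := fP _ (My n).
move=> m _; have [cm _] := range_iter_closed_subspace m.
have xvs : (fun n => x - series v n) @ \oo --> x - s.
  by apply: cvgB => //; apply: cvg_cst.
have near_range : \forall n \near \oo, range (iter m T) (x - series v n).
  by exists m => // n /= mn; apply: xS.
exact: (closed_cvg _ cm near_range _ xvs).
Qed.

Lemma shift_invertible_perp : perp dot (shift_part dot T) (invertible_part T).
Proof.
suff SI : shift_part dot T `<=` orthocomp dot (invertible_part T).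
  by move=> s t /SI; apply.
apply: hsum_sub; first exact: orthocomp_closed_subspace.
by move=> n _ [w w0 <-] x /(_ n.+1 I)[z _ <-]; apply: iter_ker_adjoint_perp.
Qed.

Lemma wold x : exists s t,
  [/\ shift_part dot T s, invertible_part T t & x = s + t].
Proof.
have rT : reduces dot T [set: H].
  split=> // _ [y yT <-]; have -> : y = 0 by apply/dot_self_eq0/yT.
  by move=> z _; rewrite linear0 dot0l.
have [s [t [Ss It xE]]] := wold_reducing setT_closed_subspace rT (I : setT x).
exists s, t; split=> //; move: Ss; apply: hsum_mono => n.
by apply: image_subset => w [].
Qed.

Lemma shift_partE : shift_part dot T = orthocomp dot (invertible_part T).
Proof. exact: orthocomp_eq shift_invertible_perp wold. Qed.

Lemma invertible_partE : invertible_part T = orthocomp dot (shift_part dot T).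
Proof.
apply: orthocomp_eq => [|x]; first by apply: perpC; apply: shift_invertible_perp.
by have [s [t [Ss It ->]]] := wold x; exists t, s; split; rewrite // addrC.
Qed.

Lemma shift_part_closed_subspace : closed_subspace (shift_part dot T).
Proof. by rewrite shift_partE; apply: orthocomp_closed_subspace. Qed.

(** * Restrictions of a near-isometry to reducing subspaces *)

Lemma wandering_part_closed_subspace (M : set H) :
  closed_subspace M -> closed_subspace (wandering_part M).
Proof.
move=> cM; have -> : wandering_part M = M `&` orthocomp dot (range T).
  apply/seteqP; split=> w [Mw w0]; split=> //.
    by move=> _ [z _ <-]; apply: dot_eq0C; move: z; apply/ker_adjointP.
  by apply/ker_adjointP => // z; apply: dot_eq0C; apply: w0; exists z.
have cO := orthocomp_closed_subspace (range T).
apply/closed_subspaceP; split=> [||a x y [Mx Ox] [My Oy]].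
- by apply: closedI; [case: cM | case: cO].
- by split; [exact: subspace0 | exact: (subspace0 cO)].
- split; first by apply: subspaceD => //; apply: subspaceZ.
  exact: (subspaceD cO (subspaceZ cO a Ox) Oy).
Qed.

(** The remainder left by [wold_reducing] lies in both the shift and the invertible part, hence
    vanishes. *)
Lemma shift_on_reducing (M : set H) : closed_subspace M -> reduces dot T M ->
  M `<=` shift_part dot T -> shift_on dot T M.
Proof.
move=> cM rM MS; exists (wandering_part M); split.
- exact: wandering_part_closed_subspace.
- by move=> w [].
- have perp_lt i j : (i < j)%N -> perp dot (iter i T @` wandering_part M)
      (iter j T @` wandering_part M).
    move=> ij _ _ [w [_ w0] <-] [w' _ <-].
    have [|z _ <-] := @range_iter_le T _ _ ij (iter j T w'); first by exists w'.
    exact: iter_ker_adjoint_perp.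
  move=> i j; rewrite neq_ltn => /orP[/perp_lt//|/perp_lt]; exact: perpC.
apply/seteqP; split=> [x Mx|].
  have [s [t [Ss It xE]]] := wold_reducing cM rM Mx.
  suff t0 : t = 0 by rewrite xE t0 addr0.
  suff St : shift_part dot T t.
    by apply: dot_self_eq0; exact: shift_invertible_perp St It.
  have -> : t = x - s by rewrite xE addrC addKr.
  apply: (subspaceB shift_part_closed_subspace); first exact: MS.
  by move: Ss; apply: hsum_mono => n; apply: image_subset => w [].
apply: hsum_sub => // n _ [w [Mw _] <-].
by apply: iter_inv => //; have [] := rM.
Qed.

(** Each vector of [M] is in the range of [T], and [reduces_split] puts its preimage in [M]; the
    inverse is bounded because [T] is bounded below. *)
Lemma invertible_on_reducing (M : set H) : closed_subspace M ->
  reduces dot T M -> M `<=` invertible_part T -> invertible_on T M.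
Proof.
move=> cM rM MI; have TM : T @` M `<=` M by case: rM.
have preim x : M x -> exists2 y, M y & T y = x.
  move=> Mx; have [y _ yx] := MI x Mx 1%N I; exists y => //.
  by apply: reduces_split cM rM _; rewrite -[T y]/(iter 1 T y) yx.
pose S x := xget 0 [set y | M y /\ T y = x].
have SP x : M x -> M (S x) /\ T (S x) = x.
  by move=> /preim[y My yx]; rewrite /S; case: xgetP => [z _ //|/(_ y)[]].
split.
  split=> // [a x y _ _|]; first exact: linearP.
  by exists 1 => x _; rewrite mul1r; apply: near_isometry_contraction.
exists S.
  split=> [_ [x Mx <-]|a x y Mx My|]; first by have [] := SP x Mx.
    have [|_ Sxy] := SP (a *: x + y).
      by apply: subspaceD => //; apply: subspaceZ.
    apply: near_isometry_inj; rewrite Sxy linearP.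
    by have [_ ->] := SP x Mx; have [_ ->] := SP y My.
  have [d d0 dT] := near_isometry_bounded_below; exists d => x Mx.
  by have [_ Sx] := SP x Mx; have := dT (S x); rewrite Sx.
move=> x Mx; split; last by have [] := SP x Mx.
apply: near_isometry_inj; have [|_ ->//] := SP (T x).
by apply: TM; exists x.
Qed.

(** [W] is orthogonal to [T M] because the [T^n W] are mutually orthogonal, and to the image of the
    complement of [M] by reduction; so it lies in the kernel of the adjoint. *)
Lemma shift_on_sub (M : set H) : closed_subspace M -> reduces dot T M ->
  shift_on dot T M -> M `<=` shift_part dot T.
Proof.
move=> cM [TM TM'] [W [cW WM Wperp ME]].
have WT w m : W w -> M m -> dot (T m) w = 0.
  move=> Ww Mm; rewrite adjointP//.
  suff h : M `<=` orthocomp dot [set adjoint dot T w] by apply: (h m Mm).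
  rewrite {1}ME; apply: hsum_sub; first exact: orthocomp_closed_subspace.
  move=> n _ [v Wv <-] _ ->; rewrite -adjointP//.
  (* One more [T] moves [T^n W] into [T^(n+1) W], while [w] is in [T^0 W]; the exponents always
     differ. *)
  by apply: (Wperp n.+1 0%N) => //; [exists v | exists w].
rewrite {1}ME; apply: hsum_mono => n; apply: image_subset => w Ww.
apply/ker_adjointP => // z; have [m [p [Mm Mp ->]]] := projection z cM.
rewrite linearD dotDl WT// add0r; apply: (TM' (T p)); first by exists p.
exact: WM.
Qed.

Lemma invertible_on_sub (M : set H) :
  invertible_on T M -> M `<=` invertible_part T.
Proof.
move=> [_ [S [SM _ _] ST]] x Mx n _; exists (iter n S x) => //.
elim: n => // n IH; have [_ TSn] := ST (iter n S x) (iter_inv n SM Mx).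
by rewrite iterSr [iter n.+1 S x]iterS TSn.
Qed.

(** If [m + p] is the image under [T^n] of [m' + p'], split likewise along [M], uniqueness of the
    splitting gives [m = T^n m']. *)
Lemma invertible_part_split (M : set H) m p : closed_subspace M ->
  reduces dot T M -> M m -> orthocomp dot M p -> invertible_part T (m + p) ->
  invertible_part T m /\ invertible_part T p.
Proof.
move=> cM [TM TM'] Mm Mp Imp; suff h n : range (iter n T) m.
  split=> n _; first exact: h.
  have -> : p = m + p - m by rewrite addrC addKr.
  apply: (subspaceB (range_iter_closed_subspace n)); first exact: Imp.
  exact: h.
have [z _ zE] := Imp n I; have [m' [p' [Mm' Mp' z_split]]] := projection z cM.
have Tm : M (iter n T m') by apply: iter_inv.
have Tp := iter_inv n TM' Mp'.
have cO := orthocomp_closed_subspace M.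
have dM : M (iter n T m' - m) by apply: subspaceB.
have dO : orthocomp dot M (iter n T m' - m).
  have -> : iter n T m' - m = p - iter n T p'.
    apply/eqP; rewrite subr_eq addrAC eq_sym subr_eq -iter_add -z_split zE.
    by rewrite addrC.
  exact: (subspaceB cO Mp Tp).
exists m' => //; apply/eqP; rewrite -subr_eq0; apply/eqP.
by apply: dot_self_eq0; apply: dO.
Qed.

(** By duality: test [m] against a vector of the invertible part, whose two components along [M]
    remain in that part. *)
Lemma shift_part_split (M : set H) m p : closed_subspace M ->
  reduces dot T M -> M m -> orthocomp dot M p -> shift_part dot T (m + p) ->
  shift_part dot T m /\ shift_part dot T p.
Proof.
move=> cM rM Mm Mp Smp; suff h : shift_part dot T m.
  split=> //; have -> : p = m + p - m by rewrite addrC addKr.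
  exact: (subspaceB shift_part_closed_subspace).
rewrite shift_partE => y Iy.
have [y1 [y2 [My1 My2 yE]]] := projection y cM.
have [I1 _] : invertible_part T y1 /\ invertible_part T y2.
  by apply: (invertible_part_split cM rM) => //; rewrite -yE.
rewrite yE dotDr (dot_eq0C (My2 _ Mm)) addr0.
by have := shift_invertible_perp Smp I1; rewrite dotDl (Mp _ My1) addr0.
Qed.

End NearIsometry.

Lemma reduces_orthocomp (T : H -> H) (M : set H) : closed_subspace M ->
  reduces dot T M <-> reduces dot T (orthocomp dot M).
Proof. by move=> cM; rewrite /reduces orthocompK//; split=> -[]. Qed.

Lemma reduces_shift_invertible (T : {linear H -> H}) (S : H -> H) :
  near_isometry dot T ->
  reduces dot S (shift_part dot T) <-> reduces dot S (invertible_part T).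
Proof.
move=> nT; rewrite (invertible_partE nT).
exact/reduces_orthocomp/shift_part_closed_subspace.
Qed.

(** * Joint decomposition for tuples of near-isometries *)

Section NearIsometryTuple.
Variables (n : nat) (T : 'I_n -> {linear H -> H}).
Hypothesis nearT : forall i, near_isometry dot (T i).

(** The Boolean, in use the truth value of [i \in A], lets one argument serve both parts. *)
Definition wold_part (b : bool) (i : 'I_n) : set H :=
  if b then shift_part dot (T i) else invertible_part (T i).

Lemma wold_part_closed_subspace b i : closed_subspace (wold_part b i).
Proof.
case: b; first exact: (shift_part_closed_subspace (nearT i)).
exact: (invertible_part_closed_subspace (nearT i)).
Qed.

Lemma wold_part_perp b i : perp dot (wold_part b i) (wold_part (~~ b) i).
Proof.
have SI := @shift_invertible_perp _ (nearT i).
by case: b; [exact: SI | exact: (perpC SI)].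
Qed.

(** The witness for [HA A] in [admits_wold]. *)
Definition joint_wold_part (A : {set 'I_n}) : set H :=
  [set x | forall i, wold_part (i \in A) i x].

Lemma joint_wold_part_perp A B : A != B ->
  perp dot (joint_wold_part A) (joint_wold_part B).
Proof.
move=> AB x y Ax By.
have [j jAB] : exists j, (j \in A) != (j \in B).
  apply/existsP; apply: contraNT AB => /existsPn AB; apply/eqP/setP => j.
  by apply/eqP/negPn/AB.
have jE : (j \in B) = ~~ (j \in A).
  by case: (j \in A) (j \in B) jAB => -[].
by apply: wold_part_perp (Ax j) _; rewrite -jE.
Qed.

Lemma joint_wold_part_closed_subspace A : closed_subspace (joint_wold_part A).
Proof.
have -> : joint_wold_part A = \bigcap_i wold_part (i \in A) i.
  by apply/seteqP; split=> [x Ax i _|x Ax i]; apply: Ax.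
apply/closed_subspaceP; split=> [|i _|a x y Ax Ay i _].
- apply: closed_bigI => i _.
  by have [] := wold_part_closed_subspace (i \in A) i.
- by apply: subspace0; apply: wold_part_closed_subspace.
- have ci := wold_part_closed_subspace (i \in A) i.
  exact: (subspaceD ci (subspaceZ ci a (Ax i I)) (Ay i I)).
Qed.

Section Reducing.
Hypothesis redT : forall i k, reduces dot (T k) (shift_part dot (T i)).

Lemma reduces_wold_part b i k : reduces dot (T k) (wold_part b i).
Proof.
have [SI _] := reduces_shift_invertible (T k) (nearT i).
by case: b; [exact: redT | exact: (SI (redT i k))].
Qed.

(** Invariance under both [T k] and its adjoint passes to intersections. *)
Lemma reduces_joint_wold_part A k : reduces dot (T k) (joint_wold_part A).
Proof.
have cT := near_isometry_continuous (nearT k).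
apply/(reduces_adjoint cT); first exact: joint_wold_part_closed_subspace.
have Tinv i := proj1 (reduces_adjoint cT (wold_part_closed_subspace (i \in A) i))
  (reduces_wold_part (i \in A) i k).
by split=> _ [x Ax <-] i; have [TA TA'] := Tinv i;
  [apply: TA | apply: TA']; exists x => //; apply: Ax.
Qed.

Lemma wold_part_split b i j m p : shift_part dot (T j) m ->
  invertible_part (T j) p -> wold_part b i (m + p) ->
  wold_part b i m /\ wold_part b i p.
Proof.
move=> Sm; rewrite (invertible_partE (nearT j)) => Ip.
have cS := shift_part_closed_subspace (nearT j).
case: b.
  exact: (shift_part_split (nearT i) cS (redT j i) Sm Ip).
exact: (invertible_part_split (nearT i) cS (redT j i) Sm Ip).
Qed.

(** Induction on a list [s] of undecided indices: outside [s], the vector [y] already lies in the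
    part prescribed by [A]. *)
Lemma joint_wold_decomposition x : exists2 u : {set 'I_n} -> H,
  (forall A, joint_wold_part A (u A)) & x = \sum_A u A.
Proof.
pose D x := exists2 u : {set 'I_n} -> H,
  (forall A, joint_wold_part A (u A)) & x = \sum_A u A.
have D_add y z : D y -> D z -> D (y + z).
  move=> [u uA ->] [v vA ->]; exists (fun A => u A + v A) => [A|].
    exact: (subspaceD (joint_wold_part_closed_subspace A) (uA A) (vA A)).
  by rewrite big_split.
suff D_partial (s : seq 'I_n) (A : {set 'I_n}) y :
    (forall j, j \notin s -> wold_part (j \in A) j y) -> D y.
  (* Initially every index is undecided, so the choice of [A] is arbitrary. *)
  by have := D_partial (enum 'I_n) [set: 'I_n]%SET x; apply=> j; rewrite mem_enum.
elim: s A y => [|i s IH] A y yA.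
  exists (fun B => if B == A then y else 0) => [B|].
    case: eqP => [-> j|_]; first exact: yA.
    exact: (subspace0 (joint_wold_part_closed_subspace B)).
  by rewrite -big_mkcond big_pred1_eq.
have [a [b [Sa Ib yE]]] := wold (nearT i) y.
have split_j j : j \notin i :: s ->
    wold_part (j \in A) j a /\ wold_part (j \in A) j b.
  by move=> /yA; rewrite yE; apply: (wold_part_split Sa Ib).
rewrite yE; apply: D_add.
  (* The shift component continues with [i] added to [A], the invertible one with [i] removed. *)
  apply: (IH (i |: A)%SET) => j js; rewrite in_setU1.
  have [->//|ji] := eqVneq j i.
  by have [|] := split_j j; first by rewrite in_cons negb_or ji.
apply: (IH (A :\ i)%SET) => j js; rewrite in_setD1.
have [->//|ji] := eqVneq j i.
by have [|] := split_j j; first by rewrite in_cons negb_or ji.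
Qed.

Lemma reduces_admits_wold : admits_wold dot T.
Proof.
exists joint_wold_part; split=> [A|A B|x|A i].
- split; first exact: joint_wold_part_closed_subspace.
  exact: reduces_joint_wold_part.
- exact: joint_wold_part_perp.
- exact: joint_wold_decomposition.
- have cA := joint_wold_part_closed_subspace A.
  have rA := reduces_joint_wold_part A i.
  split=> iA.
    apply: (shift_on_reducing (nearT i) cA rA) => x /(_ i).
    by rewrite iA.
  apply: (invertible_on_reducing (nearT i) cA rA) => x /(_ i).
  by rewrite (negPf iA).
Qed.

End Reducing.

(** Since the two parts of [T i] are mutual complements, reduction amounts to invariance of both
    under [T k]. *)
Lemma admits_wold_reduces : admits_wold dot T ->
  forall i k, reduces dot (T k) (shift_part dot (T i)).
Proof.
move=> [HA [cHA _ sumHA HAT]] i k.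
have HA_part A : HA A `<=` wold_part (i \in A) i.
  have [cA rA] := cHA A; have [sA iA] := HAT A i; rewrite /wold_part.
  case: ifPn => [/sA|/iA]; first exact: (shift_on_sub (nearT i) cA (rA i)).
  exact: invertible_on_sub.
have Tinv b : T k @` wold_part b i `<=` wold_part b i.
  move=> _ [x bx <-]; have [u uA xE] := sumHA x.
  have cb := wold_part_closed_subspace b i.
  have cb' := wold_part_closed_subspace (~~ b) i.
  pose y := \sum_(A : {set 'I_n} | (i \in A) == b) u A.
  have yb : wold_part b i y.
    by apply: (subspace_sum cb) => A /eqP <-; apply/HA_part/uA.
  have xy : x - y = \sum_(A : {set 'I_n} | (i \in A) != b) u A.
    by rewrite xE (bigID (fun A : {set 'I_n} => (i \in A) == b)) addrC addKr.
  (* [x - y] lies in both parts of [T i], which are orthogonal; so [x] is a sum of vectors of those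
     [HA A] alone that are contained in its part. *)
  have xy0 : x - y = 0.
    apply: dot_self_eq0; apply: (@wold_part_perp b i); first exact: subspaceB.
    rewrite xy; apply: (subspace_sum cb') => A.
    by move=> iAb; have -> : ~~ b = (i \in A);
      [move: iAb; case: (i \in A); case: (b) | apply/HA_part/uA].
  move/eqP: xy0; rewrite subr_eq0 => /eqP ->; rewrite /y linear_sum.
  apply: (subspace_sum cb) => A /eqP <-; apply: HA_part.
  by have [_ /(_ k)[TA _]] := cHA A; apply: TA; exists (u A).
split; first exact: (Tinv true).
by rewrite -(invertible_partE (nearT i)); exact: (Tinv false).
Qed.

End NearIsometryTuple.

End InnerProduct.

Theorem theorem5p2 (R : realType) (H : completeNormedModType R[i])
    (dot : {dot H for Num.conj}) (dot_norm : induces_norm dot)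
    (sepH : separable H) (n : nat) (T : 'I_n -> {linear H -> H})
    (nearT : forall i, near_isometry dot (T i)) :
  (admits_wold dot T <->
     forall i k : 'I_n, reduces dot (T k) (shift_part dot (T i))) /\
  (admits_wold dot T <->
     forall i k : 'I_n, reduces dot (T k) (invertible_part (T i))).
Proof.
have wold_shift : admits_wold dot T <->
    forall i k : 'I_n, reduces dot (T k) (shift_part dot (T i)).
  split; first exact: admits_wold_reduces.
  exact: reduces_admits_wold.
split=> //; apply: (iff_trans wold_shift).
by split=> red i k; apply/(reduces_shift_invertible dot_norm _ (nearT i)).
Qed.
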